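(* Let $m\ge2$ and $n\ge1$ be integers and let $\mathcal{A}=(a_{i_1i_2\cdots i_m})$ be a real diagonal centrosymmetric tensor of order $m$ and dimension $n$. Then: (i) $\mathcal{A}$ has a real centrosymmetric left inverse if and only if all diagonal entries $a_{ii\cdots i}$, $i\in[n]$, of $\mathcal{A}$ are nonzero; (ii) when $m$ is even, $\mathcal{A}$ has a real centrosymmetric right inverse if and only if all diagonal entries of $\mathcal{A}$ are nonzero; (iii) when $m$ is odd, $\mathcal{A}$ has a real centrosymmetric right inverse if all diagonal entries of $\mathcal{A}$ are positive.
   Context: Write $[n]=\{1,\dots,n\}$. A real tensor of order $m$ and dimension $n$ is an array $\mathcal{A}=(a_{i_1\cdots i_m})$ of reals with $i_1,\dots,i_m\in[n]$. It is diagonal if $a_{i_1\cdots i_m}=0$ unless $i_1=\cdots=i_m$. It is centrosymmetric if $a_{i_1\cdots i_m}=a_{n-i_1+1,\dots,n-i_m+1}$ for all indices. Tensor product: for $\mathcal{A}$ of order $m\ge2$ and $\mathcal{B}$ of order $k$, both of dimension $n$, $\mathcal{A}\mathcal{B}$ has order $(m-1)(k-1)+1$, dimension $n$ and entries $(\mathcal{A}\mathcal{B})_{i\alpha_1\cdots\alpha_{m-1}}=\sum_{i_2,\dots,i_m\in[n]}a_{i i_2\cdots i_m}b_{i_2\alpha_1}\cdots b_{i_m\alpha_{m-1}}$ with $i\in[n]$, $\alpha_j\in[n]^{k-1}$. $\mathcal{I}$ denotes the identity tensor of the appropriate order, with entries $\delta_{i_1i_2\cdots}$ equal to $1$ if all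 indices are equal and $0$ otherwise. If $\mathcal{A}$ has order $m$, $\mathcal{B}$ has order $k$ (both of dimension $n$, orders $\ge2$) and $\mathcal{A}\mathcal{B}=\mathcal{I}$ (the identity tensor of order $(m-1)(k-1)+1$), then $\mathcal{A}$ is called an (order $m$) left inverse of $\mathcal{B}$ and $\mathcal{B}$ an (order $k$) right inverse of $\mathcal{A}$. ''$\mathcal{A}$ has a left (right) inverse'' means that one of some order $k\ge2$ exists. *)

(* Defs.v *)
From mathcomp Require Import all_boot all_order all_algebra.
From mathcomp Require Import reals.
Set Implicit Arguments.
Unset Strict Implicit.
Unset Printing Implicit Defensive.
Import GRing.Theory Num.Theory.
Local Open Scope ring_scope.

Definition tensor (R : realType) (m n : nat) : Type :=
  {ffun m.-tuple 'I_n -> R}.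

Definition diag_entry (R : realType) (m n : nat) (A : tensor R m n)
    (i : 'I_n) : R :=
  A (nseq_tuple m i).

Definition diagonal (R : realType) (m n : nat) (A : tensor R m n) : Prop :=
  forall t : m.-tuple 'I_n, ~~ constant t -> A t = 0.

(* On 0-based indices, [rev_ord] is i |-> n - i - 1; this is i |-> n - i + 1
   on 1-based indices. *)
Definition centrosymmetric (R : realType) (m n : nat) (A : tensor R m n) :
    Prop :=
  forall t : m.-tuple 'I_n, A t = A (map_tuple (@rev_ord n) t).

Definition idtensor (R : realType) (m n : nat) : tensor R m n :=
  [ffun t : m.-tuple 'I_n => (constant t)%:R].

(* An index of a product of tensors of orders p+1 and q+1 is a first index
   followed by p consecutive blocks of q indices; [tblock t j] is block j.
   The position passed to [inord] is always in range, since j < p and l < q. *)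
Definition tblock (n p q : nat) (t : (p * q).+1.-tuple 'I_n) (j : 'I_p) :
    q.-tuple 'I_n :=
  [tuple tnth t (inord (j * q + l).+1) | l < q].

Definition tensor_mul (R : realType) (n p q : nat)
    (A : tensor R p.+1 n) (B : tensor R q.+1 n) : tensor R (p * q).+1 n :=
  [ffun t : (p * q).+1.-tuple 'I_n =>
     \sum_(s : p.-tuple 'I_n)
        A [tuple of thead t :: s] *
        \prod_(j < p) B [tuple of tnth s j :: tblock t j]].

(* Inverses have order at least 2, written p.+2. *)
Definition left_inverse_of (R : realType) (n p q : nat)
    (B : tensor R q.+2 n) (A : tensor R p.+2 n) : Prop :=
  tensor_mul B A = idtensor R (q.+1 * p.+1).+1 n.

Definition right_inverse_of (R : realType) (n p q : nat)
    (B : tensor R q.+2 n) (A : tensor R p.+2 n) : Prop :=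
  tensor_mul A B = idtensor R (p.+1 * q.+1).+1 n.

Definition has_centrosymmetric_left_inverse (R : realType) (n p : nat)
    (A : tensor R p.+2 n) : Prop :=
  exists (q : nat) (B : tensor R q.+2 n),
    centrosymmetric B /\ left_inverse_of B A.

Definition has_centrosymmetric_right_inverse (R : realType) (n p : nat)
    (A : tensor R p.+2 n) : Prop :=
  exists (q : nat) (B : tensor R q.+2 n),
    centrosymmetric B /\ right_inverse_of B A.

(* Main.v *)
Require Import Defs.
From mathcomp Require Import all_boot all_order all_algebra.
From mathcomp Require Import reals.
Import Order.TTheory GRing.Theory Num.Theory.
Local Open Scope ring_scope.

(** Diagonal tensors multiply like scalars: [diag a * diag b = diag c] with
    [c_i = a_i * b_i ^ (m - 1)], where [m] is the order of the left factor. A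
    left inverse is therefore the matrix [diag (a_i^-1)], and a right inverse is
    the matrix [diag c] for any real solutions of [a_i * c_i ^ (m - 1) = 1].
    Conversely, for a diagonal [A], the diagonal entries of [B A = I] and
    [A B = I] read [b_i * a_i ^ k = 1] and [a_i * b_i ^ k = 1]. *)

Definition diag_tensor (R : realType) (m n : nat) (c : 'I_n -> R) :
    tensor R m.+1 n :=
  [ffun t : m.+1.-tuple 'I_n => c (thead t) *+ constant t].

Lemma constantP (n m : nat) (t : m.+1.-tuple 'I_n) :
  reflect (forall k, tnth t k = thead t) (constant t).
Proof.
case/tupleP: t => x s; rewrite theadE /=.
apply: (iffP allP) => [h k | h y /tnthP[k ->]].
  by have := mem_tnth k [tuple of x :: s]; rewrite inE => /predU1P[|/h/eqP].
by apply/eqP; rewrite -(h (lift ord0 k)) tnthS.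
Qed.

Lemma constant_nseq (n m : nat) (t : m.+1.-tuple 'I_n) :
  constant t = (t == nseq_tuple m.+1 (thead t)).
Proof.
apply/constantP/eqP => [h | -> k]; last by rewrite /thead !tnth_nseq.
by apply: eq_from_tnth => k; rewrite h tnth_nseq.
Qed.

Lemma cons_nseq_tuple (n m : nat) (i : 'I_n) :
  [tuple of i :: nseq_tuple m i] = nseq_tuple m.+1 i.
Proof. exact: val_inj. Qed.

Lemma thead_nseq (n m : nat) (i : 'I_n) : thead (nseq_tuple m.+1 i) = i.
Proof. exact: tnth_nseq. Qed.

Lemma tblock_nseq (n p q : nat) (i : 'I_n) (j : 'I_p) :
  tblock (nseq_tuple (p * q).+1 i) j = nseq_tuple q i.
Proof. by apply: eq_from_tnth => l; rewrite tnth_mktuple !tnth_nseq. Qed.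

(** After the first index, the blocks cover all remaining positions. This splits the support of a
    diagonal product into one condition per factor. *)
Lemma constant_tblock (n p q : nat) (t : (p * q).+1.-tuple 'I_n) :
  constant t = [forall j : 'I_p, constant (thead t :: tblock t j)].
Proof.
apply/constantP/forallP => [h j | h k].
  by apply/allP => y /tnthP[l ->] /=; rewrite tnth_mktuple h.
have [->//|k_gt0] := eqVneq k ord0.
(* Position [k > 0] is entry [k.-1 %% q] of block [k.-1 %/ q]; its existence forces [0 < q], so the
   division is genuine. *)
have kpq : (k.-1 < p * q)%N by case: k k_gt0 => -[].
have /andP[_ q_gt0] : (0 < p)%N && (0 < q)%N.
  by rewrite -muln_gt0 (leq_ltn_trans _ kpq).
have jp : (k.-1 %/ q < p)%N by rewrite ltn_divLR.
have lq : (k.-1 %% q < q)%N by rewrite ltn_mod.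
have /allP/(_ _ (mem_tnth (Ordinal lq) _))/eqP := h (Ordinal jp).
rewrite tnth_mktuple /= -divn_eq prednK ?inord_val //.
by rewrite lt0n.
Qed.

Lemma diag_tensor_diagonal (R : realType) (m n : nat) (c : 'I_n -> R) :
  diagonal (diag_tensor R m n c).
Proof. by move=> t /negbTE tN; rewrite ffunE tN. Qed.

Lemma diag_entry_diag_tensor (R : realType) (m n : nat) (c : 'I_n -> R) i :
  diag_entry (diag_tensor R m n c) i = c i.
Proof. by rewrite /diag_entry ffunE constant_nseq thead_nseq eqxx. Qed.

Lemma diagonalE (R : realType) (m n : nat) (A : tensor R m.+1 n) :
  diagonal A -> A = diag_tensor R m n (diag_entry A).
Proof.
move=> hA; apply/ffunP => t; rewrite ffunE.
have [|/hA//] := boolP (constant t).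
by rewrite constant_nseq /diag_entry => /eqP <-.
Qed.

Lemma idtensorE (R : realType) (m n : nat) :
  idtensor R m.+1 n = diag_tensor R m n (fun=> 1).
Proof. by apply/ffunP => t; rewrite !ffunE. Qed.

(** [rev_ord] is injective, so reversing indices preserves and reflects constancy. *)
Lemma diag_tensor_centrosymmetric (R : realType) (m n : nat) (c : 'I_n -> R) :
  (forall i, c (rev_ord i) = c i) -> centrosymmetric (diag_tensor R m n c).
Proof.
move=> hc t; rewrite !ffunE {2}/thead tnth_map hc; congr (_ *+ nat_of_bool _).
apply/constantP/constantP => h k.
  by rewrite /thead !tnth_map h.
by have := h k; rewrite /thead !tnth_map => /rev_ord_inj.
Qed.

Lemma centrosymmetric_diag_entry (R : realType) (m n : nat)
    (A : tensor R m n) i :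
  centrosymmetric A -> diag_entry A (rev_ord i) = diag_entry A i.
Proof.
move=> hA; rewrite /diag_entry [RHS]hA; congr (A _).
by apply: eq_from_tnth => k; rewrite tnth_map !tnth_nseq.
Qed.

(** A diagonal left factor kills every summand except the one with all summation indices equal to
    [thead t]. *)
Lemma tensor_mul_diagl (R : realType) (n p q : nat)
    (A : tensor R p.+1 n) (B : tensor R q.+1 n) t :
  diagonal A ->
  tensor_mul A B t =
  diag_entry A (thead t) * \prod_(j < p) B [tuple of thead t :: tblock t j].
Proof.
move=> hA; rewrite ffunE (bigD1 (nseq_tuple p (thead t))) //=.
rewrite [X in _ + X]big1 => [|s sN].
  rewrite addr0 cons_nseq_tuple; congr (_ * _).
  by apply: eq_bigr => j _; rewrite tnth_nseq.
rewrite hA ?mul0r // constant_nseq theadE -cons_nseq_tuple.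
apply: contra sN => /eqP/(congr1 val)[] e.
by apply/eqP/val_inj.
Qed.

(** [B] is arbitrary, so the sum collapses through the right factors instead: at a constant index
    each is an entry of [A] at [tnth s j] followed by copies of [i]. The order [q.+2] guarantees at
    least one such copy, so the entry vanishes unless [tnth s j = i]. *)
Lemma tensor_mul_diagr_entry (R : realType) (n p q : nat)
    (B : tensor R p.+1 n) (A : tensor R q.+2 n) i :
  diagonal A ->
  diag_entry (tensor_mul B A) i = diag_entry B i * diag_entry A i ^+ p.
Proof.
move=> hA; rewrite {1}/diag_entry ffunE thead_nseq.
under eq_bigr => s _ do under eq_bigr => j _ do rewrite tblock_nseq.
rewrite (bigD1 (nseq_tuple p i)) //= [X in _ + X]big1 => [|s sN].
  rewrite addr0 cons_nseq_tuple; congr (_ * _).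
  under eq_bigr => j _ do rewrite tnth_nseq cons_nseq_tuple.
  by rewrite prodr_const card_ord.
have [j jN] : exists j, tnth s j != i.
  apply/existsP; rewrite -negb_forall; apply: contra sN => /forallP h.
  by apply/eqP/eq_from_tnth => j; rewrite tnth_nseq (eqP (h j)).
rewrite (bigD1 j) //= hA ?mul0r ?mulr0 //=.
by rewrite eq_sym (negbTE jN).
Qed.

Lemma tensor_mul_diagl_entry (R : realType) (n p q : nat)
    (A : tensor R p.+1 n) (B : tensor R q.+1 n) i :
  diagonal A ->
  diag_entry (tensor_mul A B) i = diag_entry A i * diag_entry B i ^+ p.
Proof.
move=> hA; rewrite {1}/diag_entry tensor_mul_diagl // thead_nseq.
under eq_bigr => j _ do rewrite tblock_nseq cons_nseq_tuple.
by rewrite prodr_const card_ord.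
Qed.

Lemma tensor_mul_diag (R : realType) (n p q : nat) (a b : 'I_n -> R) :
  tensor_mul (diag_tensor R p n a) (diag_tensor R q n b) =
  diag_tensor R (p * q) n (fun i => a i * b i ^+ p).
Proof.
apply/ffunP => t; rewrite tensor_mul_diagl; last exact: diag_tensor_diagonal.
rewrite diag_entry_diag_tensor ffunE constant_tblock.
have [/forallP h|] :=
  boolP [forall j : 'I_p, constant (thead t :: tblock t j)].
  rewrite mulr1n; congr (_ * _).
  under eq_bigr => j _ do rewrite ffunE theadE h mulr1n.
  by rewrite prodr_const card_ord.
(* Off the diagonal some block differs from the first index, and its factor is zero. *)
rewrite negb_forall => /existsP[j jN].
by rewrite (bigD1 j) //= ffunE (negbTE jN) mul0r mulr0.
Qed.

Lemma diag_entry_idtensor (R : realType) (m n : nat) (i : 'I_n) :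
  diag_entry (idtensor R m.+1 n) i = 1.
Proof. by rewrite idtensorE diag_entry_diag_tensor. Qed.

Lemma pos_root_exists (R : rcfType) (k : nat) (y : R) :
  0 <= y -> exists x : R, x ^+ k.+1 = y.
Proof.
move=> y0; pose p : {poly R} := 'X^(k.+1) - y%:P.
(* The endpoint [1 + y] is at least 1, so its power [k.+1] is at least [1 + y], hence at least
   [y]. *)
have [||x _ /rootP] := @poly_ivt R p 0 (1 + y); first by rewrite addr_ge0.
  rewrite !hornerE expr0n /= sub0r oppr_le0 y0 /= subr_ge0.
  have y1 : 1 <= 1 + y by rewrite lerDl.
  apply: (@le_trans _ _ (1 + y)); first by rewrite lerDr.
  by rewrite exprS ler_peMr ?exprn_ege1 ?addr_ge0.
by rewrite !hornerE => /eqP; rewrite subr_eq0 => /eqP <-; exists x.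
Qed.

Lemma odd_root_exists (R : rcfType) (k : nat) (y : R) :
  odd k -> exists x : R, x ^+ k = y.
Proof.
case: k => // k ko; have [x xE] := @pos_root_exists R k `|y| (normr_ge0 y).
have [y0|/ltW y0] := leP 0 y; first by exists x; rewrite xE ger0_norm.
exists (- x); rewrite exprNn -signr_odd ko expr1 mulN1r xE.
by rewrite ler0_norm // opprK.
Qed.

Section DiagonalInverses.
Variables (R : realType) (n m : nat) (A : tensor R m.+2 n).
Hypotheses (hdiag : diagonal A) (hcs : centrosymmetric A).

Lemma left_inverse_diag_neq0 :
  has_centrosymmetric_left_inverse A -> forall i, diag_entry A i <> 0.
Proof.
move=> [q [B [_ BA]]] i Ai0.
have := @tensor_mul_diagr_entry R n _ _ B A i hdiag.
(* The exponent is [q.+1], never zero, so a zero entry of [A] would give [1 = 0]. *)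
rewrite BA diag_entry_idtensor Ai0 expr0n mulr0 => /eqP.
by rewrite oner_eq0.
Qed.

Lemma diag_neq0_left_inverse :
  (forall i, diag_entry A i <> 0) -> has_centrosymmetric_left_inverse A.
Proof.
(* With a left factor of order 2 the exponent is 1, so no roots are needed. *)
move=> A0; exists 0, (diag_tensor R 1 n (fun i => (diag_entry A i)^-1)); split.
  apply: diag_tensor_centrosymmetric => i.
  by rewrite centrosymmetric_diag_entry.
rewrite /left_inverse_of {2}(diagonalE _ _ _ _ hdiag) tensor_mul_diag idtensorE.
apply/ffunP => t; rewrite !ffunE expr1 mulVf //.
exact/eqP.
Qed.

Lemma right_inverse_diag_neq0 :
  has_centrosymmetric_right_inverse A -> forall i, diag_entry A i <> 0.
Proof.
move=> [q [B [_ AB]]] i Ai0.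
have := @tensor_mul_diagl_entry R n _ _ A B i hdiag.
by rewrite AB diag_entry_idtensor Ai0 mul0r => /eqP; rewrite oner_eq0.
Qed.

(** Isolates the solvability of the root equations, the point where even and odd orders differ. *)
Lemma diag_root_right_inverse :
  (forall i, exists x, x ^+ m.+1 = (diag_entry A i)^-1) ->
  (forall i, diag_entry A i <> 0) -> has_centrosymmetric_right_inverse A.
Proof.
move=> hx A0.
(* The boolean form lets [xchoose] select a root. *)
have {}hx i : exists x, x ^+ m.+1 == (diag_entry A i)^-1.
  by have [x xE] := hx i; exists x; apply/eqP.
exists 0, (diag_tensor R 1 n (fun i => xchoose (hx i))); split.
  (* [xchoose] depends only on the predicate, so equal entries of [A] get the
     same root. *)
  apply: diag_tensor_centrosymmetric => i; apply: eq_xchoose => x.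
  by rewrite centrosymmetric_diag_entry.
rewrite /right_inverse_of {1}(diagonalE _ _ _ _ hdiag) tensor_mul_diag.
rewrite idtensorE; apply/ffunP => t; rewrite !ffunE.
rewrite (eqP (xchooseP (hx _))) mulfV //.
exact/eqP.
Qed.

End DiagonalInverses.

Theorem theorem3p8 (R : realType) (m n : nat) (hn : (1 <= n)%N)
    (A : tensor R m.+2 n) (hdiag : diagonal A) (hcs : centrosymmetric A) :
  (has_centrosymmetric_left_inverse A <->
     forall i : 'I_n, diag_entry A i <> 0)
  /\
  (~~ odd m.+2 ->
     (has_centrosymmetric_right_inverse A <->
        forall i : 'I_n, diag_entry A i <> 0))
  /\
  (odd m.+2 ->
     (forall i : 'I_n, 0 < diag_entry A i) ->
     has_centrosymmetric_right_inverse A).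
Proof.
split; [|split].
- by split; [exact: left_inverse_diag_neq0 | exact: diag_neq0_left_inverse].
- move=> m_even; split; first exact: right_inverse_diag_neq0.
  (* The exponent [m.+1] is the order minus one, hence odd for an even order. *)
  apply: diag_root_right_inverse => // i; apply: odd_root_exists.
  by move: m_even; rewrite /= negbK.
- move=> _ A_gt0; apply: diag_root_right_inverse => // i.
    by apply: pos_root_exists; rewrite invr_ge0 ltW.
  by apply/eqP; rewrite gt_eqF.
Qed.
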